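(* Let $K_{n+1}=(N,E)$ be the complete graph on node set $N=\{0,\dots,n\}$, $n\ge 4$, and let $c=(c_1,\dots,c_m)$ be a cardinality sequence with $m\ge 2$, $2\le c_1<\dots<c_m\le n$ and $c\ne(2,3)$. Then: (i) $\dim P^{c}_{0,n\text{-path}}(K_{n+1})=|E|-3$. (ii) For $e\in E$, the nonnegativity constraint $y_e\ge 0$ defines a facet of $P^{c}_{0,n\text{-path}}(K_{n+1})$ if and only if $c\ne(2,n)$, or $c=(2,n)$ and $e$ is an internal edge.
   Context: $P^{c}_{0,n\text{-path}}(K_{n+1})\subseteq\mathbb{R}^E$ is the convex hull of incidence vectors of simple (undirected) paths in $K_{n+1}$ from node $0$ to node $n$ whose number of edges is in $\{c_1,\dots,c_m\}$. An internal edge is an edge incident with neither $0$ nor $n$.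
   Formalization: Part (ii) is stated only for e ≠ {0,n} (there y_e = 0 on the whole polytope, so no facet arises) and excludes n = 4 with c = (2,4) or (3,4) and e internal, where too few paths avoid e and the claimed facet fails. *)

(* Defs.v *)
From HB Require Import structures.
From mathcomp Require Import all_boot all_order all_algebra.

Set Implicit Arguments.
Unset Strict Implicit.
Unset Printing Implicit Defensive.

Import GRing.Theory Num.Theory.
Local Open Scope ring_scope.

Section Polytopes.

Variables (R : realFieldType) (V : lmodType R).
Implicit Types (S P : V -> Prop).

Definition convex_hull S (y : V) : Prop :=
  exists (k : nat) (x : 'I_k -> V) (a : 'I_k -> R),
    [/\ forall i, S (x i), forall i, 0 <= a i, \sum_i a i = 1
      & y = \sum_i a i *: x i].

Definition affinely_independent (k : nat) (x : 'I_k -> V) : Prop :=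
  forall a : 'I_k -> R,
    \sum_i a i = 0 -> \sum_i a i *: x i = 0 -> forall i, a i = 0.

(* Dimension as the maximum number of affinely independent points, minus one;
   it is integer-valued because the empty set has dimension -1. *)
Definition has_dim S (d : int) : Prop :=
  exists k : nat,
    [/\ d = k%:Z - 1,
        exists x : 'I_k -> V, (forall i, S (x i)) /\ affinely_independent x
      & forall (l : nat) (x : 'I_l -> V),
          (forall i, S (x i)) -> affinely_independent x -> (l <= k)%N].

(* The linear inequality f y >= b is valid for P and the face of P that it
   induces has dimension dim P - 1. *)
Definition defines_facet P (f : V -> R) (b : R) : Prop :=
  (forall y, P y -> b <= f y) /\
  exists d : int,
    has_dim P d /\ has_dim (fun y => P y /\ f y = b) (d - 1).

End Polytopes.

Section CompleteGraph.

Variable n : nat.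

Definition node : finType := 'I_n.+1.

Definition edge : finType := {e : {set node} | #|e| == 2%N}.

Definition internal (e : edge) : bool :=
  (ord0 \notin val e) && (ord_max \notin val e).

Definition adj : rel node := fun u v => u != v.

(* The node sequence 0 :: p; its number of edges is size p. *)
Definition simple_0n_path (p : seq node) : bool :=
  [&& path adj ord0 p, uniq (ord0 :: p) & last ord0 p == ord_max].

Definition path_edges (p : seq node) : seq {set node} :=
  pairmap (fun u v => [set u; v]) ord0 p.

Definition incidence_vector (R : realFieldType) (p : seq node) :
    {ffun edge -> R^o} :=
  [ffun e => (val e \in path_edges p)%:R].

Definition path_polytope (R : realFieldType) (c : seq nat) :
    {ffun edge -> R^o} -> Prop :=
  convex_hull (fun y => exists p : seq node,
    [/\ simple_0n_path p, size p \in c & y = incidence_vector R p]).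

End CompleteGraph.

Arguments path_polytope {n} R c _.

(* Main.v *)
From HB Require Import structures.
Require Import Defs.
From Stdlib Require Import Classical.
From mathcomp Require Import all_boot all_order all_algebra.
From mathcomp Require Import zify ring lra.

(**
  All incidence vectors satisfy [y(delta(0)) = 1], so affine and linear
  independence agree on the polytope and on its faces, and the dimension is
  [|E| - 1] minus the dimension of the space of [b : E -> R] that vanish on all
  the vertices concerned.

  A [0]-[n] path is a word [w] of distinct inner nodes. With [f i = b{0,i}],
  [g i = b{i,n}] and [h i k = b{i,k}], [b] evaluates on it to
  [f (first w) + sum h + g (last w)]. Exchanging the first two letters of a word
  of length at least 3 shows that [f i + f k - h i k] does not depend on [i],
  hence is a constant [d]. Then the value of a word depends only on its last
  letter, its length and the sum of [f] over its letters, so [g - f] and [f] are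
  constant, and comparing two lengths gives [f = t], [g = -t], [h = 0]. On the
  face [y_e = 0] only words avoiding [e] are available; the value [b e], which
  is then free, is redefined so that the same identities hold. For
  [c = (2, n)] and [e] incident with [0] or [n], one more vector vanishes on the
  face, see [detour_vector].
*)

Set Implicit Arguments.
Unset Strict Implicit.
Unset Printing Implicit Defensive.
Import Order.TTheory GRing.Theory Num.Theory.
Local Open Scope ring_scope.

(** * Weights of words *)

Section Words.

Variables (R : realFieldType) (T : finType).
Implicit Types (f g : T -> R) (h : T -> T -> R) (w X : seq T).

Definition chain h x w := \sum_(z <- pairmap h x w) z.

(** The empty word would stand for the path along the edge {0,n}. Its value 0 is a placeholder,
    since admissible paths have at least two edges. *)
Definition weight f g h w : R :=
  if w is x :: w' then f x + chain h x w' + g (last x w') else 0.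

Lemma chain_nil h x : chain h x [::] = 0.
Proof. by rewrite /chain big_nil. Qed.

Lemma chain_cons h x y w : chain h x (y :: w) = h x y + chain h y w.
Proof. by rewrite /chain /= big_cons. Qed.

Lemma chain_rcons h x w y :
  chain h x (rcons w y) = chain h x w + h (last x w) y.
Proof.
elim: w x => [|a w IH] x /=; first by rewrite chain_cons !chain_nil addrC.
by rewrite !chain_cons IH addrA.
Qed.

Lemma chain_rev h x w y : (forall i j, h i j = h j i) ->
  chain h x (rcons w y) = chain h y (rcons (rev w) x).
Proof.
move=> hC; elim: w x => [|a w IH] x /=.
  by rewrite !chain_cons !chain_nil hC.
by rewrite chain_cons IH rev_cons [RHS]chain_rcons last_rcons (hC x a) addrC.
Qed.

Lemma weight_rev f g h w : (forall i j, h i j = h j i) ->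
  weight f g h (rev w) = weight g f h w.
Proof.
move=> hC; case: w => [//|x w]; case/lastP: w => [|w y].
  by rewrite /= !chain_nil; ring.
rewrite -rcons_cons rev_rcons rev_cons /= !last_rcons (chain_rev x w y hC).
ring.
Qed.

(** [sorted] compares consecutive letters only, so values on edges that a word does not use may be
    redefined without changing its weight. *)
Lemma eq_weight f f' g h h' w :
  (if w is x :: _ then f x = f' x else True) ->
  sorted (fun i j => h i j == h' i j) w ->
  weight f g h w = weight f' g h' w.
Proof.
case: w => [//|x w] /= -> hw; congr (_ + _ + _).
elim: w x hw => [|y w IH] x; first by rewrite !chain_nil.
by rewrite !chain_cons /= => /andP[/eqP -> /IH ->].
Qed.

(** Each letter lies in two consecutive pairs, except the first, which [f x] completes, and the
    last, where [g] stands in for the second [f]. *)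
Lemma weight_additive f g h c x w :
  (forall i k, i != k -> h i k = f i + f k - c) -> uniq (x :: w) ->
  weight f g h (x :: w) = 2 * \sum_(i <- x :: w) f i
    + (g (last x w) - f (last x w)) - (size w)%:R * c.
Proof.
move=> hE u; rewrite /=.
suff -> : chain h x w =
    2 * (\sum_(i <- x :: w) f i) - f x - f (last x w) - (size w)%:R * c by ring.
elim: w x u => [|y w IH] x.
  by move=> _; rewrite chain_nil big_seq1 /=; ring.
rewrite cons_uniq inE negb_or -andbA => /and3P[nxy _ /IH {}IH].
rewrite chain_cons IH hE // [in RHS]big_cons /= -[(size w).+1]addn1 natrD.
ring.
Qed.

(** * Consequences of vanishing weights on words of two lengths *)

Variable N : nat.
Hypothesis cardT : #|T| = N.

(** Letters from outside [A] pad a fixed pattern to any length that the alphabet allows. Most test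
    words below arise in this way. *)
Lemma exists_word (A : seq T) z : uniq A -> (size A + z <= N)%N ->
  exists2 X, size X = z & uniq (A ++ X).
Proof.
rewrite -cardT => uA hz.
pose S := [seq x <- enum T | x \notin A].
have uS0 : uniq S by rewrite filter_uniq ?enum_uniq.
have uS : uniq (S ++ A).
  rewrite cat_uniq uA uS0 andbT.
  by apply/hasPn => x xA; rewrite mem_filter xA.
have sS : (#|T| <= size S + size A)%N.
  rewrite -size_cat cardE; apply: uniq_leq_size (enum_uniq _) _ => x _.
  by rewrite mem_cat mem_filter mem_enum andbT orNb.
exists (take z S).
  by rewrite size_takel // -(leq_add2l (size A)) (leq_trans hz) // addnC.
rewrite uniq_catC cat_uniq uA take_uniq // andbT.
apply/hasPn => x xA; apply/negP => /mem_take.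
by rewrite mem_filter xA.
Qed.

(** A word of length k weighs 2kt + d - (k-1)c. Vanishing at the lengths r < s gives (s-r)(2t-c) =
    0, so c = 2t, and then d = -2t. *)
Lemma weight_endgame f g h c d t r s :
  (forall i k, i != k -> h i k = f i + f k - c) ->
  (forall i, g i = f i + d) -> (forall i, f i = t) ->
  (0 < r < s)%N ->
  (exists2 w, uniq w & size w = r /\ weight f g h w = 0) ->
  (exists2 w, uniq w & size w = s /\ weight f g h w = 0) ->
  (forall i, g i = - t) /\ (forall i k, i != k -> h i k = 0).
Proof.
move=> hE gE fE /andP[r0 rs].
have key k w : (0 < k)%N -> uniq w -> size w = k -> weight f g h w = 0 ->
    2 * k%:R * t + d - k.-1%:R * c = 0.
  case: w => [|x w] k0 uw /= sw; first by rewrite -sw in k0.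
  have /= -> := weight_additive g hE uw.
  rewrite gE -sw /= => H; rewrite -[RHS]H.
  under eq_bigr do rewrite fE.
  by rewrite big_const_seq count_predT iter_addr_0 -[t *+ _]mulr_natl /=; ring.
move=> [w uw [sw Fw]] [w' uw' [sw' Fw']].
have E1 := key _ _ r0 uw sw Fw.
have E2 := key _ _ (leq_ltn_trans (leq0n r) rs) uw' sw' Fw'.
have : (s%:R - r%:R) * (2 * t - c) = 0.
  rewrite -[RHS](subrr 0) -{1}E2 -E1 -(prednK r0) -(prednK (ltn_trans r0 rs)) /=.
  rewrite -[r.-1.+1]addn1 -[s.-1.+1]addn1 !natrD; ring.
move=> /eqP; rewrite mulf_eq0 => /orP[|/eqP ct].
  by rewrite subr_eq0 eqr_nat => /eqP sr; rewrite sr ltnn in rs.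
have dt : d = - 2 * t.
  have ct' : c = 2 * t by lra.
  move: E1; rewrite ct' -{1}(prednK r0) -[r.-1.+1]addn1 natrD => E1.
  rewrite -[LHS]subr0 -E1; ring.
split=> [i|i k ik]; first by rewrite gE fE dt; ring.
by rewrite hE // !fE; lra.
Qed.

Lemma uniq_swap x y w : uniq [:: x, y & w] = uniq [:: y, x & w].
Proof. by rewrite (perm_uniq (permEl (perm_catCA [:: x] [:: y] w))). Qed.

(** Both words share [h i j] and all that follows [k]. Adding [f k] to both sides makes each side
    symmetric in the ends of its edge. *)
Lemma weight_swap_head f g h i j k X : (forall i j, h i j = h j i) ->
  weight f g h [:: i, j, k & X] = 0 -> weight f g h [:: j, i, k & X] = 0 ->
  f i + f k - h i k = f j + f k - h j k.
Proof.
rewrite /= !chain_cons => hC Hi Hj; rewrite (hC j i) in Hj; lra.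
Qed.

(** Once [g - f] is constant, the order of the letters no longer matters. *)
Lemma weight_shifted f g h c d w :
  (forall i k, i != k -> h i k = f i + f k - c) ->
  (forall i, g i = f i + d) -> uniq w -> (0 < size w)%N ->
  weight f g h w = 2 * \sum_(i <- w) f i + d - (size w).-1%:R * c.
Proof.
case: w => [//|x w] hE gE uw _.
by rewrite (weight_additive g hE uw) gE; ring.
Qed.

(** The two words have the same length and the same tail, so their weights differ by 2(f i - f
    j). *)
Lemma weight_head_eq f g h c d i j X :
  (forall i k, i != k -> h i k = f i + f k - c) ->
  (forall i, g i = f i + d) -> uniq [:: i, j & X] ->
  weight f g h (i :: X) = 0 -> weight f g h (j :: X) = 0 -> f i = f j.
Proof.
move=> hE gE; rewrite cons_uniq inE negb_or => /andP[/andP[_ iX] ujX].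
have uiX : uniq (i :: X) by move: ujX => /= /andP[_ ->]; rewrite iX.
rewrite !(weight_shifted hE gE) //=.
rewrite !big_cons => H1 H2; lra.
Qed.

(** Any two edges of a complete graph are joined by a third: pass from {i,k} to {k,a} and then to
    {a,b}. *)
Lemma edge_fun_const (P : pred T) (kappa : T -> T -> R) :
  (forall i k, kappa i k = kappa k i) ->
  (forall i j k, uniq [:: i; j; k] -> P i -> P j -> P k ->
     kappa i k = kappa j k) ->
  forall i k a b, P i -> P k -> P a -> P b -> i != k -> a != b ->
    kappa i k = kappa a b.
Proof.
move=> kC K.
have K' i j k : P i -> P j -> P k -> i != k -> j != k -> kappa i k = kappa j k.
  move=> Pi Pj Pk ik jk; have [->//|ij] := eqVneq i j.
  by apply: K => //=; rewrite !inE negb_or ij ik jk.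
move=> i k a b Pi Pk Pa Pb ik ab.
have [ka|ka] := eqVneq k a.
  by subst k; rewrite (kC a b); apply: K' => //; rewrite eq_sym.
rewrite (K' i a k) // 1?eq_sym // (kC a k) (kC a b); apply: K' => //.
by rewrite eq_sym.
Qed.

Lemma weight_vanish_full f g h r s : (forall i j, h i j = h j i) ->
  (0 < r < s)%N -> (3 <= s <= N)%N ->
  (forall w, uniq w -> size w \in [:: r; s] -> weight f g h w = 0) ->
  exists t, [/\ forall i, f i = t, forall i, g i = - t
    & forall i k, i != k -> h i k = 0].
Proof.
move=> hC r0s; have /andP[r0 rs] := r0s; move=> /andP[s3 sN] H.
have s_rs : s \in [:: r; s] by rewrite !inE eqxx orbT.
have [[|a [|b []]] // _ uab] := @exists_word [::] 2 isT (leq_trans (ltnW s3) sN).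
have ab : a != b by move: uab; rewrite /= inE andbT.
pose kappa i k := f i + f k - h i k.
(* Since s is at least 3, the first two letters can be exchanged in front of a third, so [kappa] is
   the constant [kappa a b]. *)
have hE i k : i != k -> h i k = f i + f k - kappa a b.
  move=> ik; rewrite -(@edge_fun_const predT kappa _ _ i k) //.
  - by rewrite /kappa; ring.
  - by move=> x y; rewrite /kappa hC; ring.
  move=> x y z u _ _ _.
  have [|X sX uX] := @exists_word [:: x; y; z] (s - 3) u; first by rewrite /= subnKC.
  apply: (@weight_swap_head f g h x y z X hC); apply: H.
  - exact: uX.
  - by rewrite !inE /= sX; apply/orP; right; apply/eqP; lia.
  - by rewrite uniq_swap.
  - by rewrite !inE /= sX; apply/orP; right; apply/eqP; lia.
(* The words X i a and X a i have the same letters, so comparing their weights leaves only the two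
   last-letter corrections. *)
have gE i : g i = f i + (g a - f a).
  have [->|ia] := eqVneq i a; first by ring.
  have [||X sX uX] := @exists_word [:: i; a] (s - 2).
  - by rewrite /= inE ia.
  - by move=> /=; lia.
  have sz : (size X).+2 = s by lia.
  have u1 : uniq (rcons (rcons X i) a).
    by rewrite -!cats1 -catA uniq_catC.
  have u2 : uniq (rcons (rcons X a) i).
    rewrite -(perm_uniq (_ : perm_eq (rcons (rcons X i) a) _)) //.
    by rewrite -!cats1 -!catA perm_cat2l (perm_catC [:: i]).
  have {}gE w : uniq w -> size w = s ->
       2 * \sum_(i <- w) f i + (g (last a w) - f (last a w))
       = (size w).-1%:R * kappa a b.
    move=> uw sw; have := H w uw; rewrite sw !inE eqxx orbT => /(_ isT).
    case: w uw sw => [|x w] uw sw; first by move: sw s3 => /= <-.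
    rewrite (weight_additive g hE uw) => E.
    rewrite -sw; exact: (subr0_eq E).
  have := gE _ u1; have := gE _ u2; rewrite !last_rcons !size_rcons.
  move=> /(_ sz) E2 /(_ sz) E1; move: E1 E2; rewrite !big_rcons /=; lra.
(* Since r < N, a word of length r omits some letter, so [i] and [a] can replace each other in front
   of a common tail. *)
have fE i : f i = f a.
  have [->//|ia] := eqVneq i a.
  have [||X sX uX] := @exists_word [:: i; a] (r - 1).
  - by rewrite /= inE ia.
  - by move=> /=; lia.
  have [uiX uaX] : uniq (i :: X) /\ uniq (a :: X).
    by move: uX; rewrite /= inE negb_or => /and3P[/andP[_ ->] -> ->].
  apply: (weight_head_eq hE gE uX); apply: H => //=;
    by rewrite sX !inE; apply/orP; left; apply/eqP; lia.
exists (f a).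
have word z : z \in [:: r; s] ->
    exists2 w, uniq w & size w = z /\ weight f g h w = 0.
  move=> zrs; have [|w sw uw] := @exists_word [::] z isT.
    by move: zrs; rewrite !inE => /orP[/eqP->|/eqP->] /=; lia.
  by exists w => //; rewrite sw H ?sw.
have [gt h0] := weight_endgame hE gE fE r0s (word r (mem_head _ _)) (word s s_rs).
by split.
Qed.

(** These words are the paths that avoid the edge {0,m}. They never read [f m], so the proof resets
    it to the value that makes [h] additive at [m] too. *)
Lemma weight_vanish_off_head m f g h r s : (forall i j, h i j = h j i) ->
  (0 < r < s)%N -> (3 <= s <= N)%N -> (r, s) <> (1%N, N) ->
  (forall w, uniq w -> size w \in [:: r; s] -> head m w != m ->
     weight f g h w = 0) ->
  exists t, [/\ forall i, i != m -> f i = t, forall i, g i = - t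
    & forall i k, i != k -> h i k = 0].
Proof.
move=> hC r0s; have /andP[r0 rs] := r0s; move=> /andP[s3 sN] nrs H.
have [[|a [|b []]] // _ umab] := @exists_word [:: m] 2 isT (leq_trans s3 sN).
have [am bm ab] : [/\ a != m, b != m & a != b].
  move: umab; rewrite /= !inE negb_or andbT => /andP[/andP[ma mb] ->].
  by rewrite eq_sym ma eq_sym mb.
have s_rs : s \in [:: r; s] by rewrite !inE eqxx orbT.
pose kappa i k := f i + f k - h i k.
(* [i] and [j] take turns at the head and must differ from [m]; the third letter [k] may be [m]. *)
have K i j k : uniq [:: i; j; k] -> i != m -> j != m -> kappa i k = kappa j k.
  move=> u im jm.
  have [|X sX uX] := @exists_word [:: i; j; k] (s - 3) u; first by rewrite /= subnKC.
  have sz : (size X).+3 = s by rewrite sX -addn3 subnK.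
  have uX' : uniq [:: j, i, k & X] by rewrite uniq_swap.
  by apply: (@weight_swap_head f g h i j k X hC); apply: H => //; rewrite /= sz.
pose c := kappa a b.
(* The value at [m] is the solution of [h a m = f a + f' m - c]. *)
pose f' i := if i == m then c + h a m - f a else f i.
have f'E i : i != m -> f' i = f i by rewrite /f' => /negPf ->.
have hEm k : k != m -> h k m = f' k + f' m - c.
  move=> km; rewrite f'E // /f' eqxx.
  have [->|ka] := eqVneq k a; first by ring.
  have := K k a m; rewrite /kappa /= !inE negb_or ka km am => /(_ isT isT isT).
  by lra.
have hE i k : i != k -> h i k = f' i + f' k - c.
  move=> ik; have [im|im] := eqVneq i m.
    by rewrite hC im hEm -?im 1?eq_sym //; ring.
  have [km|km] := eqVneq k m; first by rewrite km hEm.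
  rewrite !f'E // /c -(@edge_fun_const (predC1 m) kappa _ _ i k) //.
  - by rewrite /kappa; ring.
  - by move=> x y; rewrite /kappa hC; ring.
  by move=> x y z u xm ym _; apply: K.
have {}H w : uniq w -> size w \in [:: r; s] -> head m w != m ->
    weight f' g h w = 0.
  move=> uw sw hw; rewrite -[RHS](H w uw sw hw); apply: eq_weight.
    by case: w hw {uw sw} => //= x w /f'E.
  by case: w {uw sw hw} => //= x w; apply/(pathP x) => i _; rewrite eqxx.
have lastE w : uniq w -> size w = s -> head m w != m ->
     2 * \sum_(i <- w) f' i + (g (last m w) - f' (last m w))
     = (size w).-1%:R * c.
  move=> uw sw hw; have := H w uw; rewrite sw => /(_ s_rs hw).
  case: w uw sw hw => [|x w] uw sw hw; first by move: sw s3 => /= <-.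
  rewrite (weight_additive g hE uw) => E.
  rewrite -sw; exact: (subr0_eq E).
(* A first letter [x] other than [m] keeps both words admissible while [i] and [m] exchange the last
   two places. *)
have gEm i : i != m -> g i - f' i = g m - f' m.
  move=> im; have [||[|x []] // _ ux] := @exists_word [:: i; m] 1.
  - by rewrite /= inE im.
  - by rewrite /=; lia.
  have [|X sX uX] := @exists_word [:: i; m; x] (s - 3) ux; first by rewrite /= subnKC.
  have xm : x != m.
    by move: ux; rewrite /= !inE => /and3P[_]; rewrite eq_sym.
  have sz : (size X).+3 = s by rewrite sX -addn3 subnK.
  have u1 : uniq (x :: rcons (rcons X i) m).
    by rewrite -cats1 -cats1 -catA -cat_cons uniq_catC.
  have u2 : uniq (x :: rcons (rcons X m) i).
    rewrite -(perm_uniq (_ : perm_eq (x :: rcons (rcons X i) m) _)) //.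
    by rewrite perm_cons -!cats1 -!catA perm_cat2l (perm_catC [:: i]).
  have := lastE _ u1; have := lastE _ u2.
  rewrite /= !last_rcons !size_rcons => /(_ sz xm) E2 /(_ sz xm) E1.
  by move: E1 E2; rewrite !big_cons !big_rcons /=; lra.
have gE i : g i = f' i + (g a - f' a).
  have [->|im] := eqVneq i m; first by have := gEm a am; lra.
  by have := gEm a am; have := gEm i im; lra.
(* Length at least 2 lets [m] stand second, and length below N lets [i] replace it there. The pair
   (1,N) offers no such length. *)
have [z z_rs /andP[z2 zN]] : exists2 z, z \in [:: r; s] & (2 <= z < N)%N.
  have [r1|r1] := eqVneq r 1%N; last by exists r; rewrite ?mem_head //; lia.
  exists s => //; rewrite (ltnW s3) [(_ < _)%N]ltn_neqAle sN andbT.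
  by apply/eqP => sN'; apply: nrs; rewrite r1 sN'.
have f'm i : i != m -> f' i = f' m.
  move=> im; have [||[|x []] // _ ux] := @exists_word [:: i; m] 1.
  - by rewrite /= inE im.
  - by rewrite /=; lia.
  have [|X sX uX] := @exists_word [:: i; m; x] (z - 2) ux.
    by clear -z2 zN; rewrite /=; lia.
  have xm : x != m.
    by move: ux; rewrite /= !inE => /and3P[_]; rewrite eq_sym.
  have sz : (size X).+2 = z by rewrite sX -addn2 subnK.
  move: uX; rewrite /= !inE !negb_or -!andbA.
  move=> /and5P[_ ix iX mx /and3P[mX xX uX]].
  have u1 : uniq [:: x, i & X] by rewrite /= inE negb_or eq_sym ix xX iX.
  have u2 : uniq [:: x, m & X] by rewrite /= inE negb_or xm xX mX.
  have E1 : weight f' g h [:: x, i & X] = 0 by apply: H; rewrite //= sz.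
  have E2 : weight f' g h [:: x, m & X] = 0 by apply: H; rewrite //= sz.
  by move: E1 E2; rewrite !(weight_shifted hE gE) // !big_cons /=; lra.
have f'E' i : f' i = f' m by have [->//|/f'm] := eqVneq i m.
have word y : y \in [:: r; s] ->
    exists2 w, uniq w & size w = y /\ weight f' g h w = 0.
  move=> yrs; have y1 : (0 < y <= N)%N.
    by clear -yrs r0 rs sN; move: yrs; rewrite !inE => /orP[] /eqP -> /=; lia.
  have [|w sw uw] := @exists_word [:: a] (y - 1) isT.
    by clear -y1; rewrite /=; lia.
  have sz : (size w).+1 = y by clear -sw y1; lia.
  by exists (a :: w) => //; rewrite H //= sz.
have [gt h0] := weight_endgame hE gE f'E' r0s (word r (mem_head _ _)) (word s s_rs).
by exists (f' m); split=> // i im; rewrite -f'E.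
Qed.

(** * Words that avoid an edge between two inner nodes *)

Section Avoid.

Variables m l : T.
Hypothesis ml : m != l.

Let E x := (x == m) || (x == l).
(** For distinct x and y this says that {x,y} differs from {m,l}; [E] marks the ends of this
    forbidden edge. *)
Definition avoids : rel T :=
  fun x y => ~~ (((x == m) || (x == l)) && ((y == m) || (y == l))).

Let avoidsl i k : ~~ E i -> avoids i k.
Proof. by rewrite /avoids -/(E i) => /negPf ->. Qed.

Let avoidsr i k : ~~ E k -> avoids i k.
Proof. by rewrite /avoids -/(E k) => /negPf ->; rewrite andbF. Qed.

(** Once one end of the forbidden edge is used, only the other end can still occur, so no two
    consecutive letters are both ends. *)
Let sorted_tail i Y : E i -> uniq (i :: Y) -> sorted avoids Y.
Proof.
move=> Ei; elim: Y => [//|x [//|y Y] IH] u.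
have u' : uniq (i :: y :: Y).
  by move: u; rewrite uniq_swap => /= /andP[_ ->].
rewrite /= in IH *; rewrite IH // andbT /avoids.
apply/negP => /andP[Ex Ey]; move: u Ei Ex Ey; rewrite /= !inE !negb_or /E.
move=> /and3P[/and3P[ix iy _] /andP[xy _] _].
by do 3![case/orP => /eqP ?]; subst; rewrite ?eqxx in ix iy xy.
Qed.

Let path_tail i k Y : E i -> ~~ E k -> uniq (i :: Y) -> path avoids k Y.
Proof.
move=> Ei Ek /(sorted_tail Ei); case: Y => //= y Y ->.
by rewrite avoidsl.
Qed.

(** The exchange of [i] and [j] before [k] is admissible if [i] is an end of the forbidden edge and
    [j], [k] are not: the rest then contains at most one end. With two letters off the edge, these
    exchanges link all admissible pairs. *)
Lemma weight_avoid_additive f g h s : (forall i j, h i j = h j i) ->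
  (3 <= s <= N)%N -> (4 <= N)%N ->
  (forall w, uniq w -> size w = s -> sorted avoids w -> weight f g h w = 0) ->
  exists c, forall i k, i != k -> avoids i k -> h i k = f i + f k - c.
Proof.
move=> hC /andP[s3 sN] N4 H.
have [||[|a [|b []]] // _ u] := @exists_word [:: m; l] 2; rewrite //= ?inE ?ml //.
have [Ea Eb ab] : [/\ ~~ E a, ~~ E b & a != b].
  move: u; rewrite /E /= !inE !negb_or !andbT (eq_sym a m) (eq_sym b m).
  by rewrite (eq_sym a l) (eq_sym b l) => /and3P[/and3P[_ -> ->] /andP[-> ->] ->].
pose kappa i k := f i + f k - h i k.
have kC i k : kappa i k = kappa k i by rewrite /kappa hC; ring.
have K i j k : E i -> ~~ E j -> ~~ E k -> j != k -> kappa i k = kappa j k.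
  move=> Ei Ej Ek jk.
  have ij : i != j by apply: contraNneq Ej => <-.
  have ik : i != k by apply: contraNneq Ek => <-.
  have [||X sX uX] := @exists_word [:: i; j; k] (s - 3).
  - by rewrite /= !inE negb_or ij ik jk.
  - by rewrite /= subnKC.
  have sz : (size X).+3 = s by rewrite sX -addn3 subnK.
  have uiX : uniq (i :: X).
    by move: uX; rewrite /= !inE !negb_or => /and4P[/and3P[_ _ ->] _ _ ->].
  apply: (@weight_swap_head f g h i j k X hC); apply: H => //.
  - by rewrite /= avoidsr // avoidsl // (path_tail Ei).
  - by rewrite uniq_swap.
  by rewrite /= avoidsl // avoidsr // (path_tail Ei).
have Em : E m by rewrite /E eqxx.
(* Both sides equal [kappa] on the edge {k,k'}. *)
have Kmm k k' : ~~ E k -> ~~ E k' -> kappa m k = kappa m k'.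
  move=> Ek Ek'; have [->//|kk'] := eqVneq k k'.
  rewrite (K m k' k) // 1?eq_sym // kC; apply/esym/K => //.
(* The passage from the end [i] to the end [m] goes through [kappa x k], with [x] off the forbidden
   edge. *)
have KE i k : E i -> ~~ E k -> kappa i k = kappa m a.
  move=> Ei Ek; rewrite -(Kmm k) //.
  have [x Ex xk] : exists2 x, ~~ E x & x != k.
    have [ak|ak] := eqVneq a k; last by exists a.
    by exists b => //; rewrite -ak eq_sym.
  by rewrite (K i x k) // (K m x k).
exists (kappa m a) => i k ik.
suff kE : avoids i k -> kappa i k = kappa m a.
  by move=> /kE <-; rewrite /kappa; ring.
rewrite /avoids -/(E i) -/(E k) negb_and.
have [Ei /= Ek|nEi] := boolP (E i); first exact: KE.
have [Ek _|nEk _] := boolP (E k); first by rewrite kC KE.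
by rewrite -(K m) // KE.
Qed.

Lemma weight_vanish_avoid f g h r s : (forall i j, h i j = h j i) ->
  (0 < r < s)%N -> (3 <= s <= N)%N -> (4 <= N)%N ->
  (forall w, uniq w -> size w \in [:: r; s] -> sorted avoids w ->
     weight f g h w = 0) ->
  exists t, [/\ forall i, f i = t, forall i, g i = - t
    & forall i k, i != k -> avoids i k -> h i k = 0].
Proof.
move=> hC r0s; have /andP[r0 rs] := r0s; move=> s3N N4 H.
have /andP[s3 sN] := s3N.
have s_rs : s \in [:: r; s] by rewrite !inE eqxx orbT.
have aC : symmetric avoids by move=> x y; rewrite /avoids andbC.
have [||[|a [|b []]] // _ u] := @exists_word [:: m; l] 2; rewrite //= ?inE ?ml //.
have [Ea Eb ab] : [/\ ~~ E a, ~~ E b & a != b].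
  move: u; rewrite /E /= !inE !negb_or !andbT (eq_sym a m) (eq_sym b m).
  by rewrite (eq_sym a l) (eq_sym b l) => /and3P[/and3P[_ -> ->] /andP[-> ->] ->].
have Em : E m by rewrite /E eqxx.
have [|c hE0] := @weight_avoid_additive f g h s hC s3N N4.
  by move=> w uw sw; apply: H; rewrite ?sw.
(* Reversing words exchanges [f] and [g], so [h] is additive with respect to [g] as well, with its
   own constant. *)
have [|c' hE1] := @weight_avoid_additive g f h s hC s3N N4.
  move=> w uw sw aw; rewrite -weight_rev // H ?rev_uniq ?size_rev ?sw //.
  by rewrite rev_sorted (eq_sorted (e' := avoids)).
have other k : exists2 x, ~~ E x & x != k.
  have [ak|ak] := eqVneq a k; last by exists a.
  by exists b => //; rewrite -ak eq_sym.
have nE i k : E i -> ~~ E k -> i != k by move=> Ei; apply: contraNneq => <-.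
have q2 i k : i != k -> avoids i k -> (g i - f i) + (g k - f k) = c' - c.
  by move=> ik aik; have := hE0 i k ik aik; rewrite hE1 //; lra.
(* By [q2], the values of [g - f] at the ends of an admissible pair add up to [c' - c]. On a
   triangle of admissible pairs each value is therefore half of it, and every letter lies in such a
   triangle. *)
pose d := (c' - c) / 2.
have gE i : g i = f i + d.
  suff [x [y [ix iy xy [aix aiy axy]]]] : exists x y, [/\ i != x, i != y, x != y &
      [/\ avoids i x, avoids i y & avoids x y]].
    by have := q2 _ _ ix aix; have := q2 _ _ iy aiy; have := q2 _ _ xy axy;
       rewrite /d; lra.
  have [Ei|nEi] := boolP (E i).
    exists a, b; split; [exact: nE|exact: nE|exact: ab|].
    by split; [exact: avoidsr|exact: avoidsr|exact: avoidsl].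
  have [x Ex xi] := other i.
  exists x, m; split; [by rewrite eq_sym|by rewrite eq_sym nE|by rewrite eq_sym nE|].
  by split; exact: avoidsl.
(* The value of [h] on the forbidden edge is never read, so it is set to the additive one. *)
pose h' i k := if avoids i k then h i k else f i + f k - c.
have hE i k : i != k -> h' i k = f i + f k - c.
  by move=> ik; rewrite /h'; case: ifP => // /hE0 ->.
have {}H w : uniq w -> size w \in [:: r; s] -> sorted avoids w ->
    weight f g h' w = 0.
  move=> uw sw aw; rewrite -[RHS](H w uw sw aw); apply: eq_weight.
    by case: (w).
  by apply: sub_sorted aw => x y axy; rewrite /h' axy.
have fij i j : E i -> ~~ E j -> f i = f j.
  move=> Ei Ej; have ij := nE _ _ Ei Ej.
  (* If the common tail is not empty, it starts with a letter [k] off the forbidden edge, which may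
     follow both [i] and [j]. *)
  have [X sX [uX Xi Xj]] : exists2 X, size X = (r - 1)%N &
      [/\ uniq [:: i, j & X], path avoids i X & path avoids j X].
    have [r1|r1] := eqVneq r 1%N.
      by exists [::]; rewrite ?r1 //= inE ij.
    have [k Ek kj] := other j.
    have [||X sX uX] := @exists_word [:: i; j; k] (r - 2).
    - by rewrite /= !inE negb_or ij nE //= eq_sym kj.
    - by clear -r0 r1 rs sN; rewrite /=; lia.
    exists (k :: X); first by clear -r0 r1 rs sX; rewrite /= sX; lia.
    have uiX : uniq (i :: X).
      by move: uX; rewrite /= !inE !negb_or => /and4P[/and3P[_ _ ->] _ _ ->].
    split; [exact: uX|by rewrite /= avoidsr // (path_tail Ei)|].
    by rewrite /= avoidsl // (path_tail Ei).
  have sz : (size X).+1 = r by rewrite sX -addn1 subnK.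
  have [uiX ujX] : uniq (i :: X) /\ uniq (j :: X).
    by move: uX; rewrite /= inE negb_or => /and3P[/andP[_ ->] -> ->].
  by apply: (weight_head_eq hE gE uX); apply: H; rewrite //= sz mem_head.
have fE i : f i = f a.
  have [Ei|nEi] := boolP (E i); first exact: fij.
  by rewrite -(fij m i) // (fij m a).
have word y : y \in [:: r; s] ->
    exists2 w, uniq w & size w = y /\ weight f g h' w = 0.
  move=> yrs; have y1 : (0 < y <= N)%N.
    by clear -yrs r0 rs sN; move: yrs; rewrite !inE => /orP[] /eqP -> /=; lia.
  have [y1'|y2] := eqVneq y 1%N.
    by exists [:: m] => //; rewrite H //= -y1'.
  have [||X sX uX] := @exists_word [:: m; a] (y - 2).
  - by rewrite /= inE nE.
  - by clear -y1 y2 N4; rewrite /=; lia.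
  have sz : (size X).+2 = y by clear -sX y1 y2; lia.
  have umX : uniq (m :: X).
    by move: uX; rewrite /= !inE !negb_or => /and3P[/andP[_ ->] _ ->].
  exists [:: m, a & X] => //; rewrite H //= ?sz //.
  by rewrite avoidsr // (path_tail Em).
have [gt h0] := weight_endgame hE gE fE r0s (word r (mem_head _ _)) (word s s_rs).
exists (f a); split=> // i k ik aik.
by rewrite -(h0 i k ik) /h' aik.
Qed.

(** Single letters give g = -f. The two orders of an admissible pair then give h = f k - f i and h =
    f i - f k, so h = 0 and f i = f k; a letter off the forbidden edge links all letters. *)
Lemma weight_vanish_avoid12 f g h : (forall i j, h i j = h j i) ->
  (3 <= N)%N ->
  (forall w, uniq w -> size w \in [:: 1; 2]%N -> sorted avoids w ->
     weight f g h w = 0) ->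
  exists t, [/\ forall i, f i = t, forall i, g i = - t
    & forall i k, i != k -> avoids i k -> h i k = 0].
Proof.
move=> hC N3 H.
have [||[|a []] // _ u] := @exists_word [:: m; l] 1; rewrite //= ?inE ?ml //.
have Ea : ~~ E a.
  move: u; rewrite /E /= !inE !negb_or !andbT (eq_sym a m) (eq_sym a l).
  by move=> /andP[/andP[_ -> ->]].
have gE i : g i = - f i.
  by have := H [:: i] isT isT isT; rewrite /= chain_nil; lra.
have fh i k : i != k -> avoids i k -> f i = f k /\ h i k = 0.
  move=> ik aik; have := H [:: i; k]; have := H [:: k; i].
  rewrite /= !inE !andbT ik (eq_sym k i) ik aik.
  have -> : avoids k i by rewrite /avoids andbC.
  rewrite !chain_cons !chain_nil !gE (hC k i).
  move=> /(_ isT isT isT) H1 /(_ isT isT isT) H2.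
  by split; lra.
exists (f a); split=> [i|i|i k ik aik].
- by have [->//|ia] := eqVneq i a; have [] := fh i a ia (avoidsr _ Ea).
- have [->//|ia] := eqVneq i a; have [fi _] := fh i a ia (avoidsr _ Ea).
  by rewrite gE fi.
by have [] := fh i k ik aik.
Qed.

End Avoid.

End Words.

(** For constant f = t, the zero function [h] is additive with c = 2t. This evaluates the explicit
    vectors below on paths. *)
Lemma weight_flat (R : realFieldType) (T : finType) (f g : T -> R) h t u w :
  (forall i, f i = t) -> (forall i, g i = u) ->
  (forall i k, i != k -> h i k = 0) -> uniq w -> (0 < size w)%N ->
  weight f g h w = t + u.
Proof.
move=> fE gE h0; case: w => [//|x w] uw _.
rewrite (@weight_additive _ _ f g h (2 * t)) // => [|i k ik]; last first.
  by rewrite h0 // !fE; ring.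
under eq_bigr do rewrite fE.
rewrite big_const_seq count_predT iter_addr_0 -[t *+ _]mulr_natl /= gE fE.
rewrite -[(size w).+1]addn1 natrD; ring.
Qed.

(** * Dimension and annihilators *)

Section Annihilator.

Variables (R : realFieldType) (I : finType).
Local Notation V := {ffun I -> R^o}.
Implicit Types (b y : V) (X : seq V) (U : {vspace V}) (S : V -> Prop).

Definition dotv b y : R := \sum_i b i * y i.

Lemma dotvC b y : dotv b y = dotv y b.
Proof. by apply: eq_bigr => i _; rewrite mulrC. Qed.

Lemma dotv_is_linear b : linear_for *%R (dotv b).
Proof.
move=> a u v; rewrite /dotv mulr_sumr -big_split; apply: eq_bigr => i _.
by rewrite /= !ffunE mulrDr mulrCA.
Qed.

HB.instance Definition _ b :=
  GRing.isLinear.Build R V R *%R (dotv b) (dotv_is_linear b).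

Lemma dotv_self_eq0 y : dotv y y = 0 -> y = 0.
Proof.
move=> /eqP; rewrite psumr_eq0 => [|i _]; last by rewrite -expr2 sqr_ge0.
move=> /allP y0; apply/ffunP => i; rewrite ffunE; apply/eqP.
by have := y0 i (mem_index_enum i); rewrite /= mulf_eq0 orbb.
Qed.

Definition eval_map (k : nat) (X : k.-tuple V) (b : V) : {ffun 'I_k -> R^o} :=
  [ffun i => dotv (tnth X i) b].

Lemma eval_map_is_linear k (X : k.-tuple V) : linear (eval_map X).
Proof. by move=> a u v; apply/ffunP => i; rewrite !ffunE linearP. Qed.

HB.instance Definition _ k (X : k.-tuple V) :=
  GRing.isLinear.Build R V {ffun 'I_k -> R^o} *:%R (eval_map X)
    (eval_map_is_linear X).

Lemma dim_ffun (J : finType) : \dim {: {ffun J -> R^o}} = #|J|.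
Proof. by rewrite dimvf /dim /= muln1. Qed.

Lemma dotv_span b X y : (forall x, x \in X -> dotv b x = 0) ->
  y \in <<X>>%VS -> dotv b y = 0.
Proof.
move=> bX; rewrite -[X]/(val (in_tuple X)) => /coord_span ->.
rewrite linear_sum big1 // => i _.
by rewrite linearZ /= bX ?mulr0 // mem_nth.
Qed.

(** The k equations leave a solution space of dimension at least |I| - k, too large to lie inside
    [U]. *)
Lemma exists_annihilator (k : nat) (X : k.-tuple V) U :
  (k + \dim U < #|I|)%N ->
  exists2 b, b \notin U & forall x, x \in X -> dotv b x = 0.
Proof.
move=> kU; pose phi := linfun (eval_map X).
have dphi : (#|I| <= \dim (lker phi) + k)%N.
  rewrite -(dim_ffun I) -(limg_ker_dim phi fullv) capfv leq_add2l.
  apply: leq_trans (dimvS (subvf _)) _.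
  by rewrite dim_ffun card_ord.
have /subvPn[b] : ~~ (lker phi <= U)%VS.
  apply/negP => /dimvS dU; move: kU; rewrite ltnNge => /negP; apply.
  by rewrite (leq_trans dphi) // addnC leq_add2l.
rewrite memv_ker lfunE /= => /eqP/ffunP b0 bU; exists b => // x xX.
have /tnthP[i ->] := xX.
by have := b0 i; rewrite !ffunE dotvC.
Qed.

(** Greedy choice: while the family is short, some [b] outside [U] annihilates it. This [b] does not
    vanish on all of [S], and a point of [S] where it is nonzero extends the family. *)
Lemma exists_free S U (k : nat) :
  (forall b, (forall y, S y -> dotv b y = 0) -> b \in U) ->
  (k + \dim U <= #|I|)%N ->
  exists X : k.-tuple V, free X /\ forall x, x \in X -> S x.
Proof.
move=> SU; elim: k => [|k IH] kU; first by exists [tuple]; rewrite nil_free.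
have [|X [fX SX]] := IH; first by lia.
have [b bU bX] := @exists_annihilator _ X U kU.
have [y Sy by0] : exists2 y, S y & dotv b y <> 0.
  apply: NNPP => nex; move/negP: bU; apply; apply: SU => y Sy.
  by apply: NNPP => by0; apply: nex; exists y.
exists [tuple of y :: X]; split.
  rewrite /= free_cons fX andbT; apply/negP => /(dotv_span bX) //.
by move=> x; rewrite inE => /predU1P[->|/SX].
Qed.

(** [U] is orthogonal to the span of [X], and the dot product is positive definite, so the two
    spaces meet only in 0. *)
Lemma free_dim_le S U X :
  (forall b y, b \in U -> S y -> dotv b y = 0) ->
  free X -> (forall x, x \in X -> S x) -> (size X + \dim U <= #|I|)%N.
Proof.
move=> US /eqP fX SX; rewrite -fX -(dim_ffun I) -dimv_disjoint_sum.
  exact: dimvS (subvf _).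
apply/eqP; rewrite -subv0; apply/subvP => y /memv_capP[yX yU].
rewrite memv0; apply/eqP/dotv_self_eq0.
by apply: dotv_span yX => x /SX Sx; exact: US.
Qed.

(* Since [S] lies in a hyperplane that misses the origin, affine and linear
   independence agree on it. *)
Lemma affinely_independent_free S b (k : nat) (x : 'I_k -> V) :
  (forall y, S y -> dotv b y = 1) -> (forall i, S (x i)) ->
  affinely_independent x <-> free [tuple x i | i < k].
Proof.
move=> Sb Sx; split=> [ax|/freeP fx].
  apply/freeP => a a0; apply: ax.
    transitivity (dotv b (\sum_i a i *: x i)).
      by rewrite linear_sum; apply: eq_bigr => i _; rewrite linearZ /= Sb // mulr1.
    transitivity (dotv b 0); last by rewrite linear0.
    by congr dotv; rewrite -[RHS]a0; apply: eq_bigr => i _; rewrite nth_mktuple.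
  by rewrite -[RHS]a0; apply: eq_bigr => i _; rewrite nth_mktuple.
move=> a _ a0; apply: fx; rewrite -[RHS]a0.
by apply: eq_bigr => i _; rewrite nth_mktuple.
Qed.

(** The rank of [S] is |I| minus the dimension of its annihilator; the final -1 passes from the
    number of affinely independent points to the dimension. *)
Lemma has_dim_annihilator S U b :
  (forall y, S y -> dotv b y = 1) ->
  (forall a, a \in U <-> forall y, S y -> dotv a y = 0) ->
  has_dim S (#|I|%:Z - (\dim U)%:Z - 1).
Proof.
move=> Sb SU; have dU : (\dim U <= #|I|)%N.
  by rewrite -(dim_ffun I); apply: dimvS (subvf _).
exists (#|I| - \dim U)%N; split; first by lia.
- have [|X [fX SX]] := @exists_free S U (#|I| - \dim U)%N (fun a => (SU a).2).
    by rewrite subnK.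
  exists (tnth X); have SX' i : S (tnth X i) by apply/SX/mem_tnth.
  split=> //; apply/(affinely_independent_free Sb SX').
  rewrite (_ : [tuple tnth X i | i < _] = X) //.
  by apply: eq_from_tnth => i; rewrite tnth_mktuple.
move=> l x Sx /(affinely_independent_free Sb Sx) fx.
have := free_dim_le (S := S) (U := U) _ fx; rewrite size_tuple.
have -> : (l <= #|I| - \dim U)%N = (l + \dim U <= #|I|)%N by lia.
apply; first by move=> a y /SU; apply.
by move=> y /tnthP[i ->]; rewrite tnth_mktuple.
Qed.

(** Here [U] may be a part of the annihilator only, which still bounds the dimension from above.
    This shows that a face is too small to be a facet. *)
Lemma has_dim_le_annihilator S U b (d : int) :
  (forall y, S y -> dotv b y = 1) ->
  (forall a y, a \in U -> S y -> dotv a y = 0) ->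
  has_dim S d -> d <= #|I|%:Z - (\dim U)%:Z - 1.
Proof.
move=> Sb US [k [-> [x [Sx ax]] _]].
have fx := (affinely_independent_free Sb Sx).1 ax.
have := free_dim_le US fx; rewrite size_tuple.
have H : forall y, y \in [tuple x i | i < k] -> S y.
  by move=> y /tnthP[i ->]; rewrite tnth_mktuple.
by move=> /(_ H); lia.
Qed.

Lemma has_dim_unique S (d d' : int) : has_dim S d -> has_dim S d' -> d = d'.
Proof.
move=> [k [-> [x [Sx ax]] kmax]] [l [-> [y [Sy ay]] lmax]].
by have := kmax _ _ Sy ay; have := lmax _ _ Sx ax; lia.
Qed.

Lemma dotv_convex_hull S b r y :
  (forall x, S x -> dotv b x = r) -> convex_hull S y -> dotv b y = r.
Proof.
move=> Sb [k [x [a [Sx _ a1 ->]]]]; rewrite linear_sum.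
under eq_bigr do rewrite linearZ /= Sb //.
by rewrite -mulr_suml a1 mul1r.
Qed.

Lemma convex_hull_sub S y : S y -> convex_hull S y.
Proof.
move=> Sy; exists 1%N, (fun=> y), (fun=> 1); split=> //.
- by rewrite big_ord1.
- by rewrite big_ord1 scale1r.
Qed.

Lemma convex_hull_coord_ge0 S i y :
  (forall x, S x -> 0 <= x i) -> convex_hull S y -> 0 <= y i.
Proof.
move=> S0 [k [x [a [Sx a0 _ ->]]]]; rewrite sum_ffunE; apply: sumr_ge0 => j _.
by rewrite ffunE mulr_ge0 // S0.
Qed.

(** A sum of nonnegative terms vanishes only termwise, so every point of positive coefficient has
    coordinate [i] equal to 0. *)
Lemma convex_hull_coord_face S i y :
  (forall x, S x -> 0 <= x i) -> convex_hull S y -> y i = 0 ->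
  forall b, (forall x, S x -> x i = 0 -> dotv b x = 0) -> dotv b y = 0.
Proof.
move=> S0 [k [x [a [Sx a0 _ ->]]]]; rewrite sum_ffunE.
under eq_bigr do rewrite ffunE.
move=> /eqP; rewrite psumr_eq0 => [|j _]; last by rewrite mulr_ge0 // S0.
move=> /allP z b bS; rewrite linear_sum big1 // => j _; rewrite linearZ /=.
have := z j (mem_index_enum j); rewrite /= mulf_eq0 => /orP[/eqP->|/eqP xj].
  by rewrite mul0r.
by rewrite bS ?mulr0.
Qed.

End Annihilator.

(** * Paths as words of inner nodes *)

Lemma eq_set2 (T : finType) (x y u v : T) :
  ([set x; y] == [set u; v]) =
  ((x == u) && (y == v)) || ((x == v) && (y == u)).
Proof.
apply/eqP/orP => [/setP E|[] /andP[/eqP-> /eqP->] //]; last exact: setUC.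
have := E x; have := E y; have := E u; have := E v; rewrite !inE !eqxx ?orbT /=.
rewrite (eq_sym u x) (eq_sym v x) (eq_sym u y) (eq_sym v y).
by case: (x == u); case: (x == v); case: (y == u); case: (y == v) => //=; auto.
Qed.

Section InternalWords.

Variable n : nat.

Definition inner_node : finType :=
  {i : node n | (i != ord0) && (i != ord_max)}.

Implicit Types (w : seq inner_node) (p : seq (node n)).

Definition word_path w : seq (node n) := rcons (map val w) ord_max.

Lemma inner_node_neq0 (i : inner_node) : (val i == ord0) = false.
Proof. by have /andP[/negPf] := valP i. Qed.

Lemma inner_node_neqn (i : inner_node) : (val i == ord_max) = false.
Proof. by have /andP[_ /negPf] := valP i. Qed.

Lemma card_inner_node : (0 < n)%N -> #|inner_node| = n.-1.
Proof.
move=> n0; rewrite card_sig -cardsE cardsCs.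
rewrite (_ : ~: _ = [set ord0; ord_max]).
  rewrite cards2 card_ord (_ : ord0 != ord_max :> node n) ?subSS ?subn1 //.
  by rewrite -val_eqE /= eq_sym -lt0n.
by apply/setP => i; rewrite !inE negb_and !negbK.
Qed.

Lemma uniq_path_adj (x : node n) p : uniq (x :: p) -> path (@adj n) x p.
Proof.
elim: p x => [//|y p IH] x.
rewrite cons_uniq inE negb_or => /andP[/andP[xy _] u].
by rewrite /= /adj xy IH.
Qed.

Lemma ord0_neq_max : (0 < n)%N -> (ord0 == ord_max :> node n) = false.
Proof. by move=> n0; rewrite -val_eqE /= eq_sym; apply/negbTE; rewrite -lt0n. Qed.

Lemma word_path_simple w : (0 < n)%N -> uniq w -> simple_0n_path (word_path w).
Proof.
move=> n0 uw; have u : uniq (ord0 :: word_path w).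
  rewrite /= mem_rcons inE negb_or ord0_neq_max //= rcons_uniq.
  rewrite map_inj_uniq ?uw ?andbT; last exact: val_inj.
  by apply/andP; split; apply/negP => /mapP[i _ /esym/eqP];
    rewrite ?inner_node_neq0 ?inner_node_neqn.
by rewrite /simple_0n_path uniq_path_adj // u /word_path last_rcons /=.
Qed.

Lemma simple_path_word p : simple_0n_path p -> (0 < size p)%N ->
  exists2 w, uniq w & p = word_path w.
Proof.
case/lastP: p => [//|q y] /and3P[_ u]; rewrite last_rcons => /eqP yE _.
subst y; have {u} [q0 [qm uq]] : ord0 \notin q /\ ord_max \notin q /\ uniq q.
  by move: u; rewrite /= mem_rcons inE negb_or rcons_uniq => /and3P[/andP[_ ->] -> ->].
suff [w wE] : exists w : seq inner_node, q = map val w.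
  exists w; last by rewrite /word_path wE.
  by move: uq; rewrite wE map_inj_uniq //; exact: val_inj.
elim: q q0 qm {uq} => [|x q IH]; first by exists [::].
rewrite !inE !negb_or => /andP[x0 /IH{}IH] /andP[xm /IH[w ->]].
have xP : (x != ord0) && (x != ord_max) by rewrite eq_sym x0 eq_sym xm.
by exists ((Sub x xP : inner_node) :: w).
Qed.

(** The first node lies in no later edge. Distinctness matters because incidence vectors record
    membership, while the dot product is to be a sum along the path. *)
Lemma uniq_path_edges (x : node n) p : uniq (x :: p) ->
  uniq (pairmap (fun u v => [set u; v]) x p).
Proof.
elim: p x => [//|y p IH] x u.
have nx : x \notin y :: p by move: u => /= /andP[].
have uy : uniq (y :: p) by move: u => /= /andP[].
rewrite /= IH // andbT.
have sub z q : all (fun s : {set node n} => s \subset z :: q)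
    (pairmap (fun u v => [set u; v]) z q).
  elim: q z => [//|a q IHq] z /=; apply/andP; split.
    by apply/subsetP => c; rewrite !inE => /orP[] ->; rewrite ?orbT.
  apply: sub_all (IHq a) => s /subset_trans; apply.
  by apply/subsetP => b; rewrite !inE => ->; rewrite orbT.
apply/negP => /(allP (sub y p))/subsetP/(_ x).
by rewrite !inE eqxx => /(_ isT); rewrite -in_cons (negPf nx).
Qed.

Variant edge_spec (e : edge n) : Prop :=
| EdgeEnds of val e = [set ord0; ord_max]
| EdgeFirst (i : inner_node) of val e = [set ord0; val i]
| EdgeLast (i : inner_node) of val e = [set val i; ord_max]
| EdgeInner (i k : inner_node) of i != k & val e = [set val i; val k].

Lemma edgeP (e : edge n) : edge_spec e.
Proof.
have /cards2P[x [y [xy eE]]] := valP e.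
have node_case (z : node n) : [\/ z = ord0, z = ord_max |
    exists i : inner_node, z = val i].
  have [->|z0] := eqVneq z ord0; first exact: Or31.
  have [->|zm] := eqVneq z ord_max; first exact: Or32.
  have zP : (z != ord0) && (z != ord_max) by rewrite z0.
  by apply: Or33; exists (Sub z zP : inner_node).
case: (node_case x) => [xE|xE|[i xE]]; case: (node_case y) => [yE|yE|[k yE]];
  rewrite {x}xE {y}yE ?eqxx // in xy eE.
- exact: EdgeEnds.
- exact: (EdgeFirst (i := k)).
- by apply: EdgeEnds; rewrite eE setUC.
- by apply: (EdgeLast (i := k)); rewrite eE setUC.
- by apply: (EdgeFirst (i := i)); rewrite eE setUC.
- exact: (EdgeLast (i := i)).
- by apply: (EdgeInner (i := i) (k := k)) => //.
Qed.

Lemma internalE (e : edge n) (i k : inner_node) :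
  val e = [set val i; val k] -> internal e.
Proof.
move=> eE; rewrite /internal eE !inE !(eq_sym ord0) !(eq_sym ord_max).
by rewrite !inner_node_neq0 !inner_node_neqn.
Qed.

Definition edge_of (x y : node n) (xy : x != y) : edge n :=
  Sub [set x; y] (introT eqP (etrans (cards2 x y) (congr1 (fun b : bool => b.+1) xy))).

(** * Edge functions evaluated on words *)

Variable R : realFieldType.
Local Notation V := {ffun edge n -> R^o}.
Implicit Types (b y : V) (s : {set node n}).

(* [b] extended to all node sets by zero. *)
Definition wt b s : R := \sum_e b e * (val e == s)%:R.

Definition head_wt b (i : inner_node) := wt b [set ord0; val i].
Definition last_wt b (i : inner_node) := wt b [set val i; ord_max].
Definition inner_wt b (i k : inner_node) := wt b [set val i; val k].

Lemma inner_wtC b i k : inner_wt b i k = inner_wt b k i.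
Proof. by rewrite /inner_wt setUC. Qed.

Lemma wt_val b (e : edge n) : wt b (val e) = b e.
Proof.
rewrite /wt (bigD1 e) //= eqxx mulr1 big1 ?addr0 // => e' ne.
by rewrite val_eqE (negPf ne) mulr0.
Qed.

Lemma dotv_incidence b p : uniq (ord0 :: p) ->
  dotv b (incidence_vector R p) = \sum_(s <- path_edges p) wt b s.
Proof.
move=> u; rewrite /wt exchange_big /=; apply: eq_bigr => e _.
rewrite -mulr_sumr ffunE; congr (_ * _).
have : uniq (path_edges p) by exact: uniq_path_edges.
elim: (path_edges p) => [|s ps IH]; first by rewrite big_nil.
rewrite cons_uniq big_cons inE => /andP[nps /IH <-].
by have [->|_] := eqVneq (val e) s; rewrite ?(negPf nps) ?addr0 ?add0r.
Qed.

Lemma dotv_word b w : (0 < n)%N -> uniq w -> (0 < size w)%N ->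
  dotv b (incidence_vector R (word_path w)) =
  weight (head_wt b) (last_wt b) (inner_wt b) w.
Proof.
move=> n0 uw w0; rewrite dotv_incidence; last first.
  by have /and3P[] := word_path_simple n0 uw.
case: w uw w0 => [//|x w] _ _.
rewrite /path_edges /word_path /= big_cons -addrA; congr (_ + _).
elim: w x => [|y w IH] x; first by rewrite /= big_seq1 chain_nil add0r.
by rewrite /= big_cons chain_cons -addrA -IH.
Qed.

Definition set_vector (F : {set node n} -> R) : V := [ffun e => F (val e)].

Lemma wt_set_vector F s : #|s| == 2%N -> wt (set_vector F) s = F s.
Proof. by move=> s2; rewrite -[s in LHS](SubK (edge n) s2) wt_val ffunE SubK. Qed.

End InternalWords.

(** * The path polytope *)

Section PathPolytope.

Variables (R : realFieldType) (n : nat) (c : seq nat).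
Hypothesis n4 : (4 <= n)%N.
Hypothesis c_range : forall k, k \in c -> (2 <= k <= n)%N.

Local Notation V := {ffun edge n -> R^o}.
Local Notation T := (inner_node n).
Implicit Types (b y : V) (s : {set node n}) (e : edge n).

Let n0 : (0 < n)%N. Proof. exact: leq_trans n4. Qed.
Let n3 : (2 < n.-1)%N. Proof. by rewrite ltn_predRL. Qed.
Let cardT : #|T| = n.-1. Proof. exact: card_inner_node. Qed.

(** * Vertices of the polytope and the equations that they satisfy *)

Definition path_vertex y : Prop := exists p : seq (node n),
  [/\ simple_0n_path p, size p \in c & y = incidence_vector R p].

Lemma path_vertex_word y : path_vertex y ->
  exists w : seq T, [/\ uniq w, (0 < size w)%N, (size w).+1 \in c
    & y = incidence_vector R (word_path w)].
Proof.
move=> [p [sp pc ->]]; have /andP[p2 _] := c_range pc.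
have [|w uw pE] := simple_path_word sp; first exact: ltnW.
have sz : size p = (size w).+1 by rewrite pE size_rcons size_map.
exists w; split; rewrite -?sz -?pE //.
by rewrite -ltnS -sz.
Qed.

Lemma word_path_vertex (w : seq T) : uniq w -> (size w).+1 \in c ->
  path_vertex (incidence_vector R (word_path w)).
Proof.
move=> uw wc; exists (word_path w); split=> //; first exact: word_path_simple.
by rewrite size_rcons size_map.
Qed.

Lemma path_vertex_ge0 e y : path_vertex y -> 0 <= y e.
Proof. by move=> [p [_ _ ->]]; rewrite ffunE ler0n. Qed.

(** The four vectors are the left-hand sides of y({0,n}) = 0, y(delta(0)) - y(delta(n)) = 0, y_e = 0
    and y(delta(0)) = 1, in this order. *)
Definition ends_vector : V := set_vector (fun s => (s == [set ord0; ord_max])%:R).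
Definition flow_vector : V :=
  set_vector (fun s => (ord0 \in s)%:R - (ord_max \in s)%:R).
Definition unit_vector e : V := set_vector (fun s => (s == val e)%:R).
Definition source_vector : V := set_vector (fun s => (ord0 \in s)%:R).

Let card0 (i : T) : #|[set ord0; val i]| == 2%N.
Proof. by rewrite cards2 (eq_sym ord0) inner_node_neq0. Qed.
Let cardn (i : T) : #|[set val i; ord_max]| == 2%N.
Proof. by rewrite cards2 inner_node_neqn. Qed.
Let cardi (i k : T) : i != k -> #|[set val i; val k]| == 2%N.
Proof. by move=> ik; rewrite cards2 val_eqE ik. Qed.

Let i0 (i : T) : (val i == ord0) = false. Proof. exact: inner_node_neq0. Qed.
Let iN (i : T) : (val i == ord_max) = false. Proof. exact: inner_node_neqn. Qed.
Let z0 (i : T) : (ord0 == val i) = false. Proof. by rewrite eq_sym i0. Qed.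
Let zN (i : T) : (ord_max == val i) = false. Proof. by rewrite eq_sym iN. Qed.
Let z0N : (ord0 == ord_max :> node n) = false. Proof. exact: ord0_neq_max. Qed.
Let zN0 : (ord_max == ord0 :> node n) = false. Proof. by rewrite eq_sym. Qed.

Let neqs := (i0, iN, z0, zN, z0N, zN0).

Lemma dotv_ends y : path_vertex y -> dotv ends_vector y = 0.
Proof.
move=> /path_vertex_word[w [uw w0 _ ->]]; rewrite dotv_word //.
rewrite (@weight_flat _ _ _ _ _ 0 0) ?addr0 // => [i|i|i k ik].
- by rewrite /head_wt wt_set_vector // eq_set2 !neqs !andbF.
- by rewrite /last_wt wt_set_vector // eq_set2 !neqs.
by rewrite /inner_wt wt_set_vector ?cardi // eq_set2 !neqs.
Qed.

Lemma dotv_flow y : path_vertex y -> dotv flow_vector y = 0.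
Proof.
move=> /path_vertex_word[w [uw w0 _ ->]]; rewrite dotv_word //.
rewrite (@weight_flat _ _ _ _ _ 1 (-1)) ?subrr // => [i|i|i k ik].
- by rewrite /head_wt wt_set_vector // !inE !neqs !eqxx subr0.
- by rewrite /last_wt wt_set_vector // !inE !neqs !eqxx sub0r.
by rewrite /inner_wt wt_set_vector ?cardi // !inE !neqs subrr.
Qed.

Lemma dotv_source y : path_vertex y -> dotv source_vector y = 1.
Proof.
move=> /path_vertex_word[w [uw w0 _ ->]]; rewrite dotv_word //.
rewrite (@weight_flat _ _ _ _ _ 1 0) ?addr0 // => [i|i|i k ik].
- by rewrite /head_wt wt_set_vector // !inE !neqs !eqxx.
- by rewrite /last_wt wt_set_vector // !inE !neqs.
by rewrite /inner_wt wt_set_vector ?cardi // !inE !neqs.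
Qed.

Lemma dotv_unit e y : dotv (unit_vector e) y = y e.
Proof.
rewrite /dotv (bigD1 e) //= ffunE eqxx mul1r big1 ?addr0 // => e' ne.
by rewrite ffunE val_eqE (negPf ne) mul0r.
Qed.

Lemma wt_unit e s : wt (unit_vector e) s = (s == val e)%:R.
Proof.
rewrite /wt (bigD1 e) //= ffunE eqxx mul1r eq_sym big1 ?addr0 // => e' ne.
by rewrite ffunE val_eqE (negPf ne) mul0r.
Qed.

Lemma free_cons_coord e (v : V) (X : seq V) : v e != 0 ->
  (forall x, x \in X -> x e = 0) -> free X -> free (v :: X).
Proof.
move=> ve Xe fX; rewrite free_cons fX andbT; apply/negP => vX.
move/eqP: ve; apply; rewrite -dotv_unit; apply: dotv_span vX => x /Xe.
by rewrite dotv_unit.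
Qed.

Let exists_inner (A : seq T) : uniq A -> (size A < n.-1)%N ->
  exists i : T, i \notin A.
Proof.
move=> uA sA; have [|[|i []] // _] := exists_word cardT (z := 1) uA.
  by rewrite addn1.
by rewrite uniq_catC /= => /andP[]; exists i.
Qed.

Let ends_edge : edge n := edge_of (negbT z0N).
Let first_edge (i : T) : edge n := edge_of (negbT (z0 i)).

Lemma free_ends_flow e : val e <> [set ord0; ord_max] ->
  free [:: ends_vector; flow_vector; unit_vector e].
Proof.
move=> eN; apply: (@free_cons_coord ends_edge).
- by rewrite ffunE eqxx oner_neq0.
- move=> x; rewrite !inE => /orP[]/eqP->; rewrite ffunE /=.
    by rewrite !inE !neqs !eqxx subrr.
  by rewrite (_ : _ == _ = false) //; apply/eqP => /esym.
(* On an edge {0,i} other than [e] the flow vector is 1 and the unit vector is 0. *)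
have [i iE] : exists i : T, [set ord0; val i] != val e.
  have [i _] := @exists_inner [::] isT (ltnW (ltnW n3)).
  have [ie|ie] := eqVneq [set ord0; val i] (val e); last by exists i.
  have [k ki] := @exists_inner [:: i] isT (ltnW n3).
  exists k; rewrite -ie eq_set2 eqxx /= !neqs /= val_eqE.
  by move: ki; rewrite inE => /negPf ->.
apply: (@free_cons_coord (first_edge i)).
- by rewrite ffunE /= !inE !neqs eqxx subr0 oner_neq0.
- by move=> x; rewrite inE => /eqP->; rewrite ffunE /= (negPf iE).
apply: (@free_cons_coord e); rewrite ?nil_free //.
by rewrite ffunE eqxx oner_neq0.
Qed.

Lemma flow_coord b t e : val e <> [set ord0; ord_max] ->
  (forall i : T, val e = [set ord0; val i] -> head_wt b i = t) ->
  (forall i : T, val e = [set val i; ord_max] -> last_wt b i = - t) ->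
  (forall i k : T, i != k -> val e = [set val i; val k] ->
     inner_wt b i k = 0) ->
  b e = t * flow_vector e.
Proof.
move=> eN; rewrite ffunE -wt_val.
case: (edgeP e) => [//|i eE /(_ i eE) fE _ _|i eE _ /(_ i eE) gE _|].
- by rewrite eE -[LHS]/(head_wt b i) fE !inE !neqs !eqxx subr0 mulr1.
- by rewrite eE -[LHS]/(last_wt b i) gE !inE !neqs !eqxx sub0r mulrN1.
move=> i k ik eE _ _ /(_ i k ik eE) hE.
by rewrite eE -[LHS]/(inner_wt b i k) hE !inE !neqs subrr mulr0.
Qed.

Let ends_flow_coord e : val e = [set ord0; ord_max] -> flow_vector e = 0.
Proof. by move=> eE; rewrite ffunE eE !inE !neqs !eqxx subrr. Qed.

(** The value of [b] on {0,n} is unconstrained and is absorbed by [ends_vector]. *)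
Lemma mem_ends_flow b t :
  (forall e, val e <> [set ord0; ord_max] -> b e = t * flow_vector e) ->
  b \in <<[:: ends_vector; flow_vector]>>%VS.
Proof.
move=> bE; rewrite (_ : b = b ends_edge *: ends_vector + t *: flow_vector).
  by rewrite memvD ?memvZ // memv_span // !inE eqxx ?orbT.
apply/ffunP => e.
have -> : (b ends_edge *: ends_vector + t *: flow_vector) e =
    b ends_edge * ends_vector e + t * flow_vector e by rewrite !ffunE.
have [eE|eN] := eqVneq (val e) [set ord0; ord_max].
  have -> : e = ends_edge by apply/val_inj.
  by rewrite ends_flow_coord // ffunE eqxx mulr0 mulr1 addr0.
by rewrite [ends_vector e]ffunE (negPf eN) mulr0 add0r; apply/bE/eqP.
Qed.

(** A multiple of the unit vector corrects [b] at [e], which reduces the claim to the span of the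
    first two vectors. *)
Lemma mem_ends_flow_unit e b t : val e <> [set ord0; ord_max] ->
  (forall e', val e' <> [set ord0; ord_max] -> e' != e ->
     b e' = t * flow_vector e') ->
  b \in <<[:: ends_vector; flow_vector; unit_vector e]>>%VS.
Proof.
move=> eN bE; pose u := b e - t * flow_vector e.
have : b - u *: unit_vector e \in <<[:: ends_vector; flow_vector]>>%VS.
  apply: (@mem_ends_flow _ t) => e' e'N; rewrite !ffunE.
  rewrite -[_ *: _]/(u * (val e' == val e)%:R) val_eqE.
  have [->|ne] := eqVneq e' e; first by rewrite /u ffunE mulr1 opprB addrC subrK.
  by rewrite mulr0 subr0 (bE e') // ffunE.
move=> bU; rewrite -[b](subrK (u *: unit_vector e)) memvD //.
  apply: subvP bU; apply: sub_span => x; rewrite !inE.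
  by case/orP => ->; rewrite ?orbT.
by rewrite memvZ // memv_span // !inE eqxx !orbT.
Qed.

(** The weight given by [unit_vector e] is the coordinate y_e of the path, so these words lie on the
    face y_e = 0. The next two facts do the same for the other kinds of edges. *)
Let first_unit (m : T) e (w : seq T) : val e = [set ord0; val m] ->
  uniq w -> (0 < size w)%N -> head m w != m ->
  weight (head_wt (unit_vector e)) (last_wt (unit_vector e))
    (inner_wt (unit_vector e)) w = 0.
Proof.
move=> eE uw w0 wm.
rewrite (@eq_weight _ _ _ (fun=> 0) _ _ (inner_wt (unit_vector e))).
- rewrite (@weight_flat _ _ _ _ _ 0 0) ?addr0 // => [i|i k ik].
    by rewrite /last_wt wt_set_vector // eE eq_set2 !neqs ?andbF.
  by rewrite /inner_wt wt_set_vector ?cardi // eE eq_set2 !neqs ?andbF.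
- case: w wm {uw w0} => //= x w xm.
  by rewrite /head_wt wt_set_vector // eE eq_set2 !neqs eqxx /= val_eqE (negPf xm).
by case: w {uw w0 wm} => //= x w; apply/(pathP x) => i _; rewrite eqxx.
Qed.

Let last_unit (m : T) e (w : seq T) : val e = [set val m; ord_max] ->
  uniq w -> (0 < size w)%N -> head m w != m ->
  weight (last_wt (unit_vector e)) (head_wt (unit_vector e))
    (inner_wt (unit_vector e)) w = 0.
Proof.
move=> eE uw w0 wm.
rewrite (@eq_weight _ _ _ (fun=> 0) _ _ (inner_wt (unit_vector e))).
- rewrite (@weight_flat _ _ _ _ _ 0 0) ?addr0 // => [i|i k ik].
    by rewrite /head_wt wt_set_vector // eE eq_set2 !neqs ?andbF.
  by rewrite /inner_wt wt_set_vector ?cardi // eE eq_set2 !neqs ?andbF.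
- case: w wm {uw w0} => //= x w xm.
  by rewrite /last_wt wt_set_vector // eE eq_set2 !neqs eqxx /= val_eqE (negPf xm).
by case: w {uw w0 wm} => //= x w; apply/(pathP x) => i _; rewrite eqxx.
Qed.

Let inner_unit (m l : T) e (w : seq T) : val e = [set val m; val l] ->
  uniq w -> (0 < size w)%N -> sorted (avoids m l) w ->
  weight (head_wt (unit_vector e)) (last_wt (unit_vector e))
    (inner_wt (unit_vector e)) w = 0.
Proof.
move=> eE uw w0 wa.
rewrite (@eq_weight _ _ _ (head_wt (unit_vector e)) _ _ (fun _ _ => 0)).
- rewrite (@weight_flat _ _ _ _ _ 0 0) ?addr0 // => i.
    by rewrite /head_wt wt_set_vector // eE eq_set2 !neqs ?andbF.
  by rewrite /last_wt wt_set_vector // eE eq_set2 !neqs !andbF.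
- by case: (w).
apply: sub_sorted wa => i k; rewrite /avoids /inner_wt wt_unit eE eq_set2.
rewrite !val_eqE; case: (i == m); case: (i == l); case: (k == m);
  by case: (k == l).
Qed.

Let inner_face_span e (m l : T) b t : m != l -> val e = [set val m; val l] ->
  (forall i, head_wt b i = t) -> (forall i, last_wt b i = - t) ->
  (forall i k, i != k -> avoids m l i k -> inner_wt b i k = 0) ->
  b \in <<[:: ends_vector; flow_vector; unit_vector e]>>%VS.
Proof.
move=> ml eE fE gE hE.
have eN : val e <> [set ord0; ord_max].
  by apply/eqP; rewrite eE eq_set2 !neqs.
apply: (@mem_ends_flow_unit _ _ t) => // e' e'N ne; apply: flow_coord => //.
move=> i k ik e'E; apply: hE => //; apply: contra ne => /andP[Ei Ek].
rewrite -val_eqE eE e'E eq_set2 !val_eqE; move: Ei Ek ik.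
by do 2![case/orP => /eqP ->]; rewrite ?eqxx //= ?orbT.
Qed.

(** * Annihilators of the vertices and of the coordinate faces *)

Section TwoLengths.

Variables a1 a2 : nat.
Hypotheses (a1c : a1 \in c) (a2c : a2 \in c) (a12 : (a1 < a2)%N) (a24 : (4 <= a2)%N).

(** A path with k edges has k - 1 inner nodes, so [a1.-1] and [a2.-1] are the word lengths r and
    s. *)
Let r0s : (0 < a1.-1 < a2.-1)%N.
Proof. by have := c_range a1c; clear -a12; lia. Qed.
Let s3N : (3 <= a2.-1 <= n.-1)%N.
Proof. by have := c_range a2c; clear -a24; lia. Qed.

Let size_c (w : seq T) : size w \in [:: a1.-1; a2.-1] ->
  (size w).+1 \in c /\ (0 < size w)%N.
Proof.
have := c_range a1c; have := c_range a2c => a2r a1r.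
have [p1 p2] : (1 < a1)%N /\ (1 < a2)%N by move/andP: a1r => []; move/andP: a2r => [].
by rewrite !inE => /orP[]/eqP->; rewrite prednK ?a1c ?a2c ?ltn_predRL // ltnW.
Qed.

Lemma annihilator_path_vertex b :
  (forall y, path_vertex y -> dotv b y = 0) ->
  b \in <<[:: ends_vector; flow_vector]>>%VS.
Proof.
move=> bP.
have [|t [fE gE hE]] := weight_vanish_full cardT (inner_wtC b) r0s s3N
    (f := head_wt b) (g := last_wt b).
  move=> w uw /size_c[wc w0]; rewrite -dotv_word //.
  exact/bP/word_path_vertex.
apply: (@mem_ends_flow _ t) => e eN; apply: flow_coord => // i k ik _.
exact: hE.
Qed.

Lemma annihilator_first_face e (m : T) b : val e = [set ord0; val m] ->
  (a1, a2) <> (2%N, n) ->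
  (forall y, path_vertex y -> y e = 0 -> dotv b y = 0) ->
  b \in <<[:: ends_vector; flow_vector; unit_vector e]>>%VS.
Proof.
move=> eE a2n bP; have a1r := c_range a1c; have a2r := c_range a2c.
have [||t [fE gE hE]] := weight_vanish_off_head (m := m) cardT (inner_wtC b)
    r0s s3N (f := head_wt b) (g := last_wt b).
- by move=> [x1 xn]; apply: a2n; congr pair; clear -x1 xn a1r a2r; lia.
- move=> w uw /size_c[wc w0] wm; rewrite -dotv_word //.
  apply: bP; first exact: word_path_vertex.
  by rewrite -dotv_unit dotv_word // (first_unit eE).
have eN : val e <> [set ord0; ord_max].
  by apply/eqP; rewrite eE eq_set2 !neqs andbF.
apply: (@mem_ends_flow_unit _ _ t) => // e' e'N ne; apply: flow_coord => //.
- move=> i e'E; apply: fE; apply: contra ne => /eqP im.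
  by apply/eqP/val_inj; rewrite e'E im.
- by move=> i k ik _; exact: hE.
Qed.

(** Reversal exchanges the nodes 0 and n and turns this into the case of an edge at 0. The constant
    t then belongs to the edges at n, so the flow vector gets the coefficient -t. *)
Lemma annihilator_last_face e (m : T) b : val e = [set val m; ord_max] ->
  (a1, a2) <> (2%N, n) ->
  (forall y, path_vertex y -> y e = 0 -> dotv b y = 0) ->
  b \in <<[:: ends_vector; flow_vector; unit_vector e]>>%VS.
Proof.
move=> eE a2n bP; have a1r := c_range a1c; have a2r := c_range a2c.
have [||t [fE gE hE]] := weight_vanish_off_head (m := m) cardT (inner_wtC b)
    r0s s3N (f := last_wt b) (g := head_wt b).
- by move=> [x1 xn]; apply: a2n; congr pair; clear -x1 xn a1r a2r; lia.
- move=> w uw /size_c[wc w0] wm; rewrite -weight_rev; last exact: inner_wtC.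
  have [urw w0' wc'] : [/\ uniq (rev w), (0 < size (rev w))%N
      & (size (rev w)).+1 \in c] by rewrite rev_uniq size_rev.
  rewrite -dotv_word //; apply: bP; first exact: word_path_vertex.
  rewrite -dotv_unit dotv_word // weight_rev; last exact: inner_wtC.
  exact: (last_unit eE).
have eN : val e <> [set ord0; ord_max].
  by apply/eqP; rewrite eE eq_set2 !neqs.
apply: (@mem_ends_flow_unit _ _ (- t)) => // e' e'N ne; apply: flow_coord => //.
- move=> i e'E; rewrite opprK; apply: fE; apply: contra ne => /eqP im.
  by apply/eqP/val_inj; rewrite e'E im.
- by move=> i k ik _; exact: hE.
Qed.

Lemma annihilator_inner_face e (m l : T) b : m != l ->
  val e = [set val m; val l] -> (4 < n)%N ->
  (forall y, path_vertex y -> y e = 0 -> dotv b y = 0) ->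
  b \in <<[:: ends_vector; flow_vector; unit_vector e]>>%VS.
Proof.
move=> ml eE n5 bP.
have [||t [fE gE hE]] := weight_vanish_avoid cardT ml (inner_wtC b)
    r0s s3N (f := head_wt b) (g := last_wt b).
- by rewrite ltn_predRL.
- move=> w uw /size_c[wc w0] wm; rewrite -dotv_word //.
  apply: bP; first exact: word_path_vertex.
  by rewrite -dotv_unit dotv_word // (inner_unit eE).
exact: (inner_face_span ml eE fE gE hE).
Qed.

End TwoLengths.

(** Words of one and two letters suffice even with three inner nodes, which is the situation for n =
    4. *)
Lemma annihilator_inner_face23 e (m l : T) b : m != l ->
  val e = [set val m; val l] -> 2 \in c -> 3 \in c ->
  (forall y, path_vertex y -> y e = 0 -> dotv b y = 0) ->
  b \in <<[:: ends_vector; flow_vector; unit_vector e]>>%VS.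
Proof.
move=> ml eE c2 c3 bP.
have [|t [fE gE hE]] := weight_vanish_avoid12 cardT ml (inner_wtC b)
    n3 (f := head_wt b) (g := last_wt b).
  move=> w uw sw wa.
  have [wc w0] : (size w).+1 \in c /\ (0 < size w)%N.
    by move: sw; rewrite !inE => /orP[]/eqP->.
  rewrite -dotv_word //; apply: bP; first exact: word_path_vertex.
  by rewrite -dotv_unit dotv_word // (inner_unit eE).
exact: (inner_face_span ml eE fE gE hE).
Qed.

Lemma dim_span_ends_flow e : val e <> [set ord0; ord_max] ->
  \dim <<[:: ends_vector; flow_vector; unit_vector e]>> = 3%N /\
  \dim <<[:: ends_vector; flow_vector]>> = 2%N.
Proof.
move=> eN; have f3 := free_ends_flow eN; split; first exact/eqP.
apply/eqP; apply: (@catl_free _ _ [:: unit_vector e]).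
exact: f3.
Qed.

(** * Dimension of the polytope and of its coordinate faces *)

Lemma path_polytope_source y :
  path_polytope R c y -> dotv source_vector y = 1.
Proof. by apply: dotv_convex_hull; exact: dotv_source. Qed.

Lemma has_dim_path_polytope a1 a2 : a1 \in c -> a2 \in c -> (a1 < a2)%N ->
  (4 <= a2)%N -> has_dim (path_polytope (n := n) R c) (#|{: edge n}|%:Z - 3).
Proof.
move=> a1c a2c a12 a24.
(* The edge {0,i} only serves to obtain the independence of the two equations from that of a
   triple. *)
have [i _] := @exists_inner [::] isT (ltnW (ltnW n3)).
have eN : val (first_edge i) <> [set ord0; ord_max].
  by apply/eqP; rewrite eq_set2 !neqs andbF.
have [_ d2] := dim_span_ends_flow eN.
have -> : #|{: edge n}|%:Z - 3 =
    #|{: edge n}|%:Z - (\dim <<[:: ends_vector; flow_vector]>>)%:Z - 1.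
  by rewrite d2 -addrA.
apply: (has_dim_annihilator path_polytope_source) => b; split.
  move=> bU y Py; rewrite dotvC; apply: dotv_span bU => x.
  rewrite !inE dotvC => /orP[]/eqP->; apply: dotv_convex_hull Py.
    exact: dotv_ends.
  exact: dotv_flow.
move=> bP; apply: (annihilator_path_vertex a1c a2c) => // y Py.
exact/bP/convex_hull_sub.
Qed.

(** The annihilator of the face has dimension 3 instead of 2, so the dimension drops by exactly
    one. *)
Lemma facet_of_annihilator e : val e <> [set ord0; ord_max] ->
  has_dim (path_polytope (n := n) R c) (#|{: edge n}|%:Z - 3) ->
  (forall b, (forall y, path_vertex y -> y e = 0 -> dotv b y = 0) ->
     b \in <<[:: ends_vector; flow_vector; unit_vector e]>>%VS) ->
  defines_facet (path_polytope (n := n) R c) (fun y => y e) 0.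
Proof.
move=> eN dP bU; split.
  by move=> y; apply: convex_hull_coord_ge0 => x; exact: path_vertex_ge0.
exists (#|{: edge n}|%:Z - 3); split=> //.
have [d3 _] := dim_span_ends_flow eN.
have -> : #|{: edge n}|%:Z - 3 - 1 = #|{: edge n}|%:Z
    - (\dim <<[:: ends_vector; flow_vector; unit_vector e]>>)%:Z - 1.
  by rewrite d3.
apply: (has_dim_annihilator (b := source_vector)) => [y [Py _]|b].
  exact: path_polytope_source.
split=> [bS y [Py ye]|bP].
  rewrite dotvC; apply: dotv_span bS => x.
  rewrite !inE dotvC => /or3P[]/eqP->; last by rewrite dotv_unit.
    by apply: dotv_convex_hull Py; exact: dotv_ends.
  by apply: dotv_convex_hull Py; exact: dotv_flow.
by apply: bU => y Py ye; apply: bP; split=> //; exact: convex_hull_sub.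
Qed.

(* A hamiltonian path has [n - 2] internal edges and two edges at [m]; a path
   with two edges has none of either unless it passes through [m]. *)
Definition detour_vector (m : T) : V := set_vector (fun s =>
  ((ord0 \notin s) && (ord_max \notin s))%:R * 2 - (val m \in s)%:R * (n - 2)%:R).

(** The detour vector is additive with f = g and c = -2. A word of k letters weighs 2(k-1), less
    2(n-2) if it contains [m]. *)
Lemma dotv_detour e (m : T) y : c = [:: 2; n]%N ->
  val e = [set ord0; val m] \/ val e = [set val m; ord_max] ->
  path_vertex y -> y e = 0 -> dotv (detour_vector m) y = 0.
Proof.
move=> cE eE /path_vertex_word[w [uw w0 wc ->]] ye; rewrite dotv_word //.
pose f (i : T) : R := - (i == m)%:R * (n - 2)%:R.
have fE i : head_wt (detour_vector m) i = f i.
  by rewrite /head_wt wt_set_vector // !inE !neqs eqxx /= val_eqE eq_sym /f; ring.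
have gE i : last_wt (detour_vector m) i = f i.
  rewrite /last_wt wt_set_vector // !inE !neqs eqxx /= orbF val_eqE eq_sym.
  by rewrite /f ?andbF /=; ring.
case: w uw w0 wc ye => [//|x w] uw _ wc ye.
rewrite (@weight_additive _ _ _ _ _ (-2)) //; last first.
  move=> i k ik; rewrite /inner_wt wt_set_vector ?cardi // !inE !neqs /= !fE /f.
  rewrite !val_eqE !(eq_sym m).
  have [im|im] := eqVneq i m; last by have [km|km] := eqVneq k m => /=; ring.
  by rewrite im eq_sym in ik; rewrite (negPf ik) /=; ring.
rewrite fE gE subrr addr0; under eq_bigr do rewrite fE /f mulNr.
rewrite sumrN -mulr_suml.
(* A single letter other than [m] weighs 0, and the word consisting of [m] alone uses [e], against
   y_e = 0. *)
move: wc; rewrite cE !inE /= => /orP[/eqP [/size0nil wE]|/eqP wn].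
  subst w; have [xm|xm] := eqVneq x m; last first.
    by rewrite big_seq1 (negPf xm) /=; ring.
  move: ye; rewrite ffunE xm /path_edges /= !inE.
  by case: eE => ->; rewrite eqxx ?orbT => /eqP; rewrite oner_eq0.
(* A word of n - 1 distinct letters contains every inner node. *)
have mw : m \in x :: w.
  have [||_ ->] := uniq_min_size uw (s2 := enum T); last by rewrite mem_enum.
    by move=> i _; rewrite mem_enum.
  by rewrite -cardE cardT -(congr1 predn wn).
rewrite (_ : \sum_(i <- x :: w) (i == m)%:R = 1).
  have -> : (n - 2)%N = size w by rewrite -(congr1 (subn^~ 2%N) wn) /= subn2.
  by ring.
by rewrite (bigD1_seq m) //= eqxx big1 ?addr0 // => i /negPf ->.
Qed.

(** Four independent vectors vanish on the face, which bounds its dimension by |E| - 5, whereas a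
    facet has dimension |E| - 4. *)
Lemma not_facet_detour e (m : T) : c = [:: 2; n]%N ->
  val e = [set ord0; val m] \/ val e = [set val m; ord_max] ->
  has_dim (path_polytope (n := n) R c) (#|{: edge n}|%:Z - 3) ->
  ~ defines_facet (path_polytope (n := n) R c) (fun y => y e) 0.
Proof.
move=> cE eE dP [_ [d [dP' dF]]].
rewrite (has_dim_unique dP' dP) {dP d dP'} in dF.
have eN : val e <> [set ord0; ord_max].
  by apply/eqP; case: eE => ->; rewrite eq_set2 !neqs ?andbF.
pose X := [:: ends_vector; flow_vector; unit_vector e].
(* On an inner edge {j,k} that misses [m], the detour vector is 2 and the other three vectors are
   0. *)
have [j jm] := @exists_inner [:: m] isT (ltnW n3).
have [|k kjm] := @exists_inner [:: j; m] _ n3.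
  by move: jm; rewrite /= !inE => ->.
have [jm' [kj km]] : j != m /\ k != j /\ k != m.
  by move: jm kjm; rewrite !inE negb_or => -> /andP[-> ->].
have jk : val j != val k by rewrite val_eqE eq_sym.
have f4 : free (detour_vector m :: X).
  apply: (@free_cons_coord (edge_of jk)); last exact: free_ends_flow.
    rewrite ffunE /= !inE !neqs /= !val_eqE !(eq_sym m) (negPf jm') (negPf km).
    by rewrite mul1r mul0r subr0 pnatr_eq0.
  move=> x; rewrite !inE => /or3P[]/eqP->; rewrite ffunE /=.
  - by rewrite eq_set2 !neqs.
  - by rewrite !inE !neqs subrr.
  by case: eE => ->; rewrite eq_set2 !neqs ?andbF.
have := has_dim_le_annihilator (U := <<detour_vector m :: X>>%VS)
  (b := source_vector) _ _ dF.
have -> : \dim <<detour_vector m :: X>> = 4%N by exact/eqP.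
rewrite -!addrA lerD2l => H; suff: false by [].
apply: H => [y [Py _]|a y aU [Py ye]]; first exact: path_polytope_source.
rewrite dotvC; apply: dotv_span aU => x; rewrite dotvC.
rewrite !inE => /or4P[]/eqP->; last by rewrite dotv_unit.
- apply: (convex_hull_coord_face _ Py ye) => z Pz.
    exact: path_vertex_ge0 Pz.
  exact: dotv_detour cE eE Pz.
- by apply: dotv_convex_hull Py; exact: dotv_ends.
by apply: dotv_convex_hull Py; exact: dotv_flow.
Qed.

End PathPolytope.

(** * Selection of path lengths and the facet classification *)

Lemma last_two_lengths n (c : seq nat) : (2 <= size c)%N -> sorted ltn c ->
  (forall k, k \in c -> (2 <= k <= n)%N) -> c <> [:: 2; 3]%N ->
  exists a1 a2, [/\ a1 \in c, a2 \in c, (a1 < a2)%N, (4 <= a2)%N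
    & c <> [:: 2; n]%N -> (a1, a2) <> (2%N, n)].
Proof.
case/lastP: c => [//|c a2]; case/lastP: c => [//|c a1] _ cS cR c23.
have a1c : a1 \in rcons (rcons c a1) a2.
  by rewrite mem_rcons inE mem_rcons mem_head orbT.
have a2c : a2 \in rcons (rcons c a1) a2 by rewrite mem_rcons mem_head.
have := cR _ a1c; have := cR _ a2c; move=> a2r a1r; exists a1, a2.
(* With two entries, [c] is the pair (a1,a2) itself, and a2 = 3 would force (2,3). A third entry
   [a0] gives a1 > a0 >= 2, hence a1 >= 3 and a2 >= 4. *)
case/lastP: c cS cR c23 a1c a2c => [|c a0] cS cR c23 a1c a2c.
  move: cS; rewrite /= andbT => a12; split=> //.
    rewrite ltnNge; apply/negP => a23; apply: c23 => /=.
    by congr [:: _; _]; clear -a1r a12 a23; lia.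
  by move=> cN [a1E a2E]; apply: cN; rewrite /= a1E a2E.
have a0r : (2 <= a0 <= n)%N.
  by apply: cR; rewrite mem_rcons inE mem_rcons inE mem_rcons mem_head !orbT.
have [a01 a12] : (a0 < a1)%N /\ (a1 < a2)%N.
  move: cS; rewrite -!cats1 -!catA /= => cS.
  have sub := suffix_subseq c [:: a0; a1; a2].
  by have /= /and3P[-> -> _] := subseq_sorted ltn_trans sub cS.
split=> //; first by clear -a0r a01 a12; lia.
by move=> _ [a1E _]; clear -a0r a01 a1E; lia.
Qed.

(** The three excluded pairs are all those in {2,3,4}, so [c] has a third entry and starts with 2,
    3. *)
Lemma lengths_le4 (c : seq nat) : (2 <= size c)%N -> sorted ltn c ->
  (forall k, k \in c -> (2 <= k <= 4)%N) -> c <> [:: 2; 3]%N ->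
  c <> [:: 2; 4]%N -> c <> [:: 3; 4]%N -> (2 \in c) && (3 \in c).
Proof.
case: c => [|x [|y c]] // _ cS cR c23 c24 c34.
have xr := cR x (mem_head _ _).
have yr : (2 <= y <= 4)%N by apply: cR; rewrite !inE eqxx orbT.
case: c cS cR c23 c24 c34 => [|z c] cS cR c23 c24 c34.
  move: cS; rewrite /= andbT => xy; exfalso.
  have : [|| (x == 2) && (y == 3), (x == 2) && (y == 4) | (x == 3) && (y == 4)]%N.
    by clear -xr yr xy; lia.
  by case/or3P => /andP[/eqP xE /eqP yE]; [apply: c23|apply: c24|apply: c34];
    rewrite xE yE.
have zr : (2 <= z <= 4)%N by apply: cR; rewrite !inE eqxx !orbT.
move: cS => /= /and3P[xy yz _].
have [-> ->] : x = 2%N /\ y = 3%N by clear -xr yr zr xy yz; lia.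
by rewrite !inE !eqxx.
Qed.

(** On {0,n} the coordinate vanishes on the whole polytope, so the face is not proper. For n = 4 and
    internal [e], only 5 paths avoid [e] if c = (2,4) and only 6 if c = (3,4), while a facet, of
    dimension 6, needs 7 affinely independent points. The statement sets these cases apart. *)
Theorem theorem17 (R : realFieldType) (n : nat) (c : seq nat)
    (hn : (4 <= n)%N)
    (hm : (2 <= size c)%N)
    (hc_incr : sorted ltn c)
    (hc_range : forall k, k \in c -> (2 <= k <= n)%N)
    (hc23 : c <> [:: 2; 3]%N) :
  has_dim (path_polytope (n := n) R c) (#|{: edge n}|%:Z - 3)
  /\
  (forall e : edge n,
     val e <> [set ord0; ord_max] ->
     ~ (n = 4%N /\ (c = [:: 2; 4]%N \/ c = [:: 3; 4]%N) /\ internal e) ->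
     defines_facet (path_polytope (n := n) R c) (fun y => y e) 0 <->
     (c <> [:: 2; n]%N \/ (c = [:: 2; n]%N /\ internal e))).
Proof.
have [a1 [a2 [a1c a2c a12 a24 a2n]]] :=
  last_two_lengths hm hc_incr hc_range hc23.
have dP := has_dim_path_polytope R hn hc_range a1c a2c a12 a24.
split=> // e eN n4e; split=> [fe|ce].
  have [cE|cN] := eqVneq c [:: 2; n]%N; last by left; apply/eqP.
  right; split=> //; case: (edgeP e) => [//|m eE|m eE|m l _ eE].
  - by case: (not_facet_detour hn hc_range cE (or_introl eE) dP fe).
  - by case: (not_facet_detour hn hc_range cE (or_intror eE) dP fe).
  exact: internalE eE.
(* For an edge at 0 or n the case c = (2,n) is ruled out, which is what the off-head argument
   requires of the two lengths. *)
have cN : ~~ internal e -> c <> [:: 2; n]%N.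
  by case: ce => [//|[_ ->]].
apply: (facet_of_annihilator hn hc_range eN dP) => b bP.
case: (edgeP e) => [//|m eE|m eE|m l ml eE].
- apply: (annihilator_first_face hn hc_range a1c a2c a12 a24 eE) bP.
  by apply/a2n/cN; rewrite /internal eE !inE eqxx.
- apply: (annihilator_last_face hn hc_range a1c a2c a12 a24 eE) bP.
  by apply/a2n/cN; rewrite /internal eE !inE eqxx orbT andbF.
(* For n > 4 there are at least four inner nodes. For n = 4 the remaining sequences contain both 2
   and 3. *)
have [n5|n4] := ltnP 4 n.
  exact: (annihilator_inner_face hn hc_range a1c a2c a12 a24 ml eE n5 bP).
have nE : n = 4%N by apply/eqP; rewrite eqn_leq n4.
have /andP[c2 c3] : (2 \in c) && (3 \in c).
  apply: lengths_le4 => // [k kc|cE|cE]; first by rewrite -nE hc_range.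
  - by apply: n4e; split=> //; split; [left|exact: internalE eE].
  - by apply: n4e; split=> //; split; [right|exact: internalE eE].
exact: (annihilator_inner_face23 hn ml eE c2 c3 bP).
Qed.
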